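(* Let $a=(a_k)_{k\ge1}$ be a sequence of pairwise distinct complex numbers with $a_1=0$. (a) If $\mu,\lambda$ are strict partitions with $\mu\not\subset\lambda$, then $Q_{\mu;a}(x(\lambda))=P_{\mu;a}(x(\lambda))=0$. (b) For every strict partition $\mu$, $P_{\mu;a}(x(\mu))=H_a(\mu)$, where $$H_a(\mu)=\prod_{k=1}^{\ell(\mu)}(a_{\mu_k+1}\mid a)^{\mu_k}\prod_{1\le i<j\le\ell(\mu)}\frac{a_{\mu_i+1}+a_{\mu_j+1}}{a_{\mu_i+1}-a_{\mu_j+1}}.$$
   Context: A strict partition is $\lambda=(\lambda_1>\dots>\lambda_l>0)$, $\ell(\lambda)=l$; for strict $\mu,\lambda$, $\mu\subset\lambda$ means the shifted diagram of $\mu$ is contained in that of $\lambda$, i.e. $\ell(\mu)\le\ell(\lambda)$ and $\mu_i\le\lambda_i$ for all $i\le\ell(\mu)$. Put $(x\mid a)^k=\prod_{m=1}^k(x-a_m)$, $(x\mid a)^0=1$. For $\ell(\mu)=l\le n$, $$P_{\mu;a}(x_1,\dots,x_n)=\frac1{(n-l)!}\sum_{\omega\in S(n)}\prod_{i=1}^l (x_{\omega(i)}\mid a)^{\mu_i}\prod_{1\le i\le l,\ i<j\le n}\frac{x_{\omega(i)}+x_{\omega(j)}}{x_{\omega(i)}-x_{\omega(j)}},$$ $P_{\mu;a}(x_1,\dots,x_n)=0$ if $\ell(\mu)>n$, and $Q_{\mu;a}=2^{\ell(\mu)}P_{\mu;a}$; these are stable under $x_{n+1}\mapsto 0$, so evaluating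 at a finite tuple is well defined. For a strict partition $\lambda$, $x(\lambda)$ denotes the tuple $(x(\lambda)_1,\dots,x(\lambda)_{\ell(\lambda)})$ with $x(\lambda)_i=a_{\lambda_i+1}$. *)

(* Defs.v *)
From HB Require Import structures.
From mathcomp Require Import all_boot all_order all_algebra all_fingroup.
From mathcomp Require Import complex reals.

Set Implicit Arguments.
Unset Strict Implicit.
Unset Printing Implicit Defensive.

Import GRing.Theory Num.Theory.

(* Parts are stored in a sequence indexed from 0: the part written lambda_i in
   the literature (i >= 1) is nth 0 la i.-1. *)
Definition strict_partition (la : seq nat) : bool :=
  sorted gtn la && all (ltn 0) la.

(* Inclusion of shifted diagrams; since row i of a shifted diagram starts at
   column i for both partitions, it amounts to comparing row lengths. *)
Definition shifted_sub (mu la : seq nat) : bool :=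
  (size mu <= size la) && [forall i : 'I_(size mu), nth 0 mu i <= nth 0 la i].

Local Open Scope ring_scope.

Section FactorialPQ.
Variable F : fieldType.

(* The parameter sequences a are indexed from 1; the value a 0 is never used. *)
Implicit Types (a : nat -> F) (mu la : seq nat).

(* (x | a)^k *)
Definition gpow a (x : F) (k : nat) : F := \prod_(1 <= m < k.+1) (x - a m).

(* The value at the point x of the factorial P-function in n variables. The
   defining expression is used verbatim, hence it is meaningful only at points
   whose coordinates are pairwise distinct (all denominators are then nonzero);
   elsewhere the value is an artefact of x / 0 = 0. *)
Definition factorialP mu a (n : nat) (x : 'I_n -> F) : F :=
  if (size mu <= n)%N then
    ((n - size mu)`!%:R)^-1 *
    \sum_(w : 'S_n)
      ((\prod_(i < n | (i < size mu)%N) gpow a (x (w i)) (nth 0%N mu i)) *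
       \prod_(i < n | (i < size mu)%N) \prod_(j < n | (i < j)%N)
         ((x (w i) + x (w j)) / (x (w i) - x (w j))))
  else 0.

Definition factorialQ mu a (n : nat) (x : 'I_n -> F) : F :=
  2 ^+ size mu * factorialP mu a x.

(* The tuple x(lambda), with as many entries as lambda has parts. *)
Definition point_of a la : 'I_(size la) -> F :=
  fun i => a (nth 0%N la i).+1.

Definition Hprod a mu : F :=
  (\prod_(k < size mu) gpow a (a (nth 0%N mu k).+1) (nth 0%N mu k)) *
  \prod_(i < size mu) \prod_(j < size mu | (i < j)%N)
    ((a (nth 0%N mu i).+1 + a (nth 0%N mu j).+1) /
     (a (nth 0%N mu i).+1 - a (nth 0%N mu j).+1)).

End FactorialPQ.

Arguments point_of {F} a la i.

(* Main.v *)
Require Import Defs.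
From mathcomp Require Import all_boot all_order all_algebra all_fingroup.
From mathcomp Require Import complex reals.

Import GRing.Theory Num.Theory.
Local Open Scope ring_scope.

(** Since (a_(k+1) | a)^m vanishes for k < m, the summand of P_(mu;a)(x(lambda))
    indexed by a permutation w vanishes unless mu_i <= lambda_(w i) for every i.
    If mu is not contained in lambda, say mu_i > lambda_i, surviving would force
    w to map {1, ..., i} into {1, ..., i-1}. If mu = lambda, it forces w i <= i
    for all i, so only w = 1 contributes, and its summand is H_a(mu). *)

(** The factor of index [k.+1] in the product is [a k.+1 - a k.+1]. *)
Lemma gpow_shift_eq0 (F : fieldType) (a : nat -> F) (k m : nat) :
  (k < m)%N -> gpow a (a k.+1) m = 0.
Proof.
move=> ltkm; apply/eqP; rewrite prodf_seq_eq0; apply/hasP.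
by exists k.+1; rewrite ?mem_index_iota //= subrr.
Qed.

(** Turns comparisons of parts into reversed comparisons of indices. Indices must be in range: past
    the end [nth] is constantly 0, and the equivalence fails there. *)
Lemma strict_partition_leq_nth (la : seq nat) : strict_partition la ->
  {in [pred i | (i < size la)%N] &,
    forall i j, (nth 0 la i <= nth 0 la j)%N = (j <= i)%N}.
Proof.
case/andP=> la_sorted _ i j lti ltj.
have gtn_nth := @sorted_ltn_nth _ gtn (rev_trans ltn_trans) 0%N la la_sorted.
case: (ltngtP i j) => [ltij | ltji | ->]; last exact: leqnn.
- by apply/negbTE; rewrite -ltnNge; exact: gtn_nth.
- exact/ltnW/gtn_nth.
Qed.

(** Pigeonhole: otherwise [w] would inject the [i.+1] indices up to [i] into the [i] indices below
    [i]. *)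
Lemma perm_exists_leq (n : nat) (w : 'S_n) (i : 'I_n) :
  exists2 j : 'I_n, (j <= i)%N & (i <= w j)%N.
Proof.
suff /existsP[j /andP[]] : [exists j : 'I_n, (j <= i)%N && (i <= w j)%N]
  by exists j.
apply: contraT => /existsPn w_lt.
have : (#|w @: [set j : 'I_n | (j <= i)%N]| <= #|[set j : 'I_n | (j < i)%N]|)%N.
  apply/subset_leq_card/subsetP=> k /imsetP[j]; rewrite inE => leji ->.
  by have := w_lt j; rewrite leji inE ltnNge.
have -> : [set j : 'I_n | (j <= i)%N] = i |: [set j : 'I_n | (j < i)%N].
  by apply/setP=> j; rewrite !inE leq_eqVlt.
by rewrite card_imset; [rewrite cardsU1 inE ltnn ltnn | exact: perm_inj].
Qed.

Lemma perm_leq_id (n : nat) (w : 'S_n) :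
  (forall i : 'I_n, (w i <= i)%N) -> w = 1%g.
Proof.
move=> w_le; apply/permP=> i; rewrite perm1.
have [m] := ubnP (i : nat); elim: m i => // m IHm i; rewrite ltnS => leim.
have := w_le i; rewrite leq_eqVlt => /predU1P[/val_inj // | lt_wi].
(* If [w i < i], induction gives [w (w i) = w i], and injectivity cancels one [w]. *)
exact: perm_inj (IHm (w i) (leq_trans lt_wi leim)).
Qed.

Lemma prod_gpow_neq0 (F : fieldType) (a : nat -> F) (mu la : seq nat)
    (w : 'S_(size la)) :
  \prod_(i < size la | (i < size mu)%N)
     gpow a (point_of a la (w i)) (nth 0%N mu i) != 0 ->
  forall i : 'I_(size la), (i < size mu)%N ->
    (nth 0 mu i <= nth 0 la (w i))%N.
Proof.
move/prodf_neq0=> nz i lti; rewrite leqNgt; apply: contra (nz i lti) => lt_la.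
by apply/eqP/gpow_shift_eq0.
Qed.

Lemma factorialP_vanishing (F : fieldType) (a : nat -> F) (mu la : seq nat) :
  strict_partition mu -> strict_partition la -> ~~ shifted_sub mu la ->
  factorialP mu a (point_of a la) = 0.
Proof.
move=> mu_strict la_strict; rewrite /shifted_sub /factorialP.
(* If [mu] has more parts than [la], the value is 0 by definition. *)
case: leqP => //= le_size; rewrite negb_forall.
case/existsP=> i; rewrite -ltnNge => lt_la_mu.
rewrite big1 ?mulr0 // => w _.
apply/eqP; apply: contraT; rewrite mulf_eq0 negb_or.
case/andP=> /prod_gpow_neq0 le_mu_la _.
have [j leji le_iw] := perm_exists_leq _ w (widen_ord le_size i).
have ltj : (j < size mu)%N by exact: leq_ltn_trans leji (ltn_ord i).
(* Since [j <= i <= w j], one gets mu_i <= mu_j <= la_(w j) <= la_i, against the choice of [i]. *)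
have : (nth 0 mu i <= nth 0 la i)%N.
  apply: leq_trans (leq_trans (le_mu_la j ltj) _).
    by rewrite strict_partition_leq_nth ?inE.
  rewrite strict_partition_leq_nth ?inE ?ltn_ord //.
  exact: leq_trans (ltn_ord i) le_size.
by rewrite leqNgt lt_la_mu.
Qed.

Lemma factorialP_diagonal (F : fieldType) (a : nat -> F) (mu : seq nat) :
  strict_partition mu -> factorialP mu a (point_of a mu) = Hprod a mu.
Proof.
move=> mu_strict; rewrite /factorialP leqnn subnn fact0 invr1 mul1r.
rewrite (bigD1 (1%g : 'S_(size mu))) //= [X in _ + X]big1 ?addr0 => [|w w_neq1].
  rewrite /Hprod /point_of; congr (_ * _).
    by apply: eq_big => [i | i _]; rewrite ?ltn_ord ?perm1.
  apply: eq_big => [i | i _]; first by rewrite ltn_ord.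
  by apply: eq_bigr => j _; rewrite !perm1.
apply/eqP; apply: contraT; rewrite mulf_eq0 negb_or.
case/andP=> /prod_gpow_neq0 le_mu _.
case/eqP: w_neq1; apply: perm_leq_id => i.
(* Parts strictly decrease, so mu_i <= mu_(w i) says exactly [w i <= i]. *)
by rewrite -(strict_partition_leq_nth _ mu_strict) ?inE ?ltn_ord ?le_mu.
Qed.

Theorem theorem5p3 (R : realType) (a : nat -> R[i])
    (a_inj : forall i j : nat, (0 < i)%N -> (0 < j)%N -> a i = a j -> i = j)
    (a1 : a 1%N = 0) :
  (forall mu la : seq nat,
     strict_partition mu -> strict_partition la -> ~~ shifted_sub mu la ->
     factorialQ mu a (point_of a la) = 0 /\
     factorialP mu a (point_of a la) = 0) /\
  (forall mu : seq nat,
     strict_partition mu ->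
     factorialP mu a (point_of a mu) = Hprod a mu).
Proof.
split=> [mu la mu_strict la_strict not_sub | mu]; last exact: factorialP_diagonal.
by rewrite /factorialQ factorialP_vanishing ?mulr0.
Qed.
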